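(* Let $G$ be a topological Abelian group. (1) If a closed subgroup $H\leq G$ is such that $G/H\in S_{TG}(\mathbb{T})$, then $H$ is dually embedded in $G$. (2) If $G$ is in $S_{TG}(\mathbb{T})$ and $H\le G$ is a closed dually embedded subgroup, then $G/H\in S_{TG}(\mathbb{T})$.
   Context: $\mathbb{T}$ denotes the unit circle of $\mathbb{C}$ with its usual topology and multiplication. A character of a topological Abelian group is a continuous homomorphism into $\mathbb{T}$. A subgroup $H\le G$ (with the induced topology) is dually embedded in $G$ if each character of $H$ can be extended to a character of $G$. A twisted sum of topological Abelian groups is a short exact sequence $0\to Y\stackrel{\imath}{\to} X\stackrel{\pi}{\to} Z\to 0$ of topological Abelian groups and continuous homomorphisms in which $\imath$ and $\pi$ are open onto their images. It splits if there is a continuous homomorphism $\Phi:X\to Y\times Z$ such that $\Phi\circ\imath$ is the canonical inclusion $y\mapsto (y,0)$ and $\pi_Z\circ\Phi=\pi$, where $\pi_Z:Y\times Z\to Z$ is the projection (such $\Phi$ is necessarily a topological isomorphism). A topological Abelian group $G$ belongs to $S_{TG}(\mathbb{T})$ if every twisted sum of topological Abelian groups $0\to\mathbb{T}\to X\to G\to 0$ splits. *)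

(* Defs.v *)
From HB Require Import structures.
From mathcomp Require Import all_boot all_order all_algebra ring_quotient.
From mathcomp Require Import complex.
From mathcomp Require Import all_classical all_reals topology normedtype.

Set Implicit Arguments.
Unset Strict Implicit.
Unset Printing Implicit Defensive.

Import Order.TTheory GRing.Theory Num.Theory.
Import numFieldTopology.Exports numFieldNormedType.Exports.

Local Open Scope classical_set_scope.
Local Open Scope ring_scope.
Local Open Scope complex_scope.

(* [zmodType] structures are written additively: on the circle group, [x + y]
   is the product of complex numbers, [0] is the complex number 1 and [- x] is
   the inverse. *)
Record circle (R : realType) := Circle {
  circle_val : R[i];
  circle_valP : `|circle_val| == 1
}.

Section Circle.
Variable R : realType.
Local Notation T := (circle R).

HB.instance Definition _ := [isSub for @circle_val R].
HB.instance Definition _ := [Choice of T by <:].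

Fact circle_norm1 : `|1 : R[i]| == 1. Proof. by rewrite normr1. Qed.

Fact circle_normM (x y : T) : `|circle_val x * circle_val y| == 1.
Proof.
by rewrite normrM (eqP (circle_valP x)) (eqP (circle_valP y)) mulr1.
Qed.

Fact circle_normV (x : T) : `|(circle_val x)^-1| == 1.
Proof. by rewrite normfV (eqP (circle_valP x)) invr1. Qed.

Definition circle_one : T := Circle circle_norm1.
Definition circle_mul (x y : T) : T := Circle (circle_normM x y).
Definition circle_inv (x : T) : T := Circle (circle_normV x).

Fact circle_mulA : associative circle_mul.
Proof. by move=> x y z; apply: val_inj; rewrite /= mulrA. Qed.

Fact circle_mulC : commutative circle_mul.
Proof. by move=> x y; apply: val_inj; rewrite /= mulrC. Qed.

Fact circle_mul1 : left_id circle_one circle_mul.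
Proof. by move=> x; apply: val_inj; rewrite /= mul1r. Qed.

Fact circle_val_neq0 (x : T) : circle_val x != 0.
Proof. by rewrite -normr_eq0 (eqP (circle_valP x)) oner_eq0. Qed.

Fact circle_mulV : left_inverse circle_one circle_inv circle_mul.
Proof.
by move=> x; apply: val_inj; rewrite /= mulVf// circle_val_neq0.
Qed.

HB.instance Definition _ :=
  GRing.isZmodule.Build T circle_mulA circle_mulC circle_mul1 circle_mulV.

(* [R[i]^o] carries the topology of the norm of [R[i]]. *)
HB.instance Definition _ := Topological.copy T
  (initial_topology (fun z : T => circle_val z : R[i]^o)).

Fact circle_val_continuous : continuous (fun z : T => circle_val z : R[i]^o).
Proof. exact: initial_continuous. Qed.

Fact circle_sub_continuous : continuous (fun x : T * T => x.1 - x.2).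
Proof.
apply: (@continuous_comp_initial _ _ _ (fun z : T => circle_val z : R[i]^o)).
move=> x.
apply: (@cvgM R[i] _ (nbhs x) _ (fun z : T * T => circle_val z.1 : R[i]^o)
  (fun z : T * T => (circle_val z.2)^-1 : R[i]^o)).
  apply: (@continuous_comp _ _ _ fst (fun z : T => circle_val z : R[i]^o)).
    exact: cvg_fst.
  exact: circle_val_continuous.
apply: (@cvgV R[i] _ (nbhs x) _ (fun z : T * T => circle_val z.2 : R[i]^o)).
  exact: circle_val_neq0.
apply: (@continuous_comp _ _ _ snd (fun z : T => circle_val z : R[i]^o)).
  exact: cvg_snd.
exact: circle_val_continuous.
Qed.

HB.instance Definition _ :=
  PreTopologicalNmodule_isTopologicalZmodule.Build T circle_sub_continuous.

End Circle.

Section Subgroup.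
Variables (G : topologicalZmodType) (H : zmodClosed G).

Definition subgroup := {x : G | x \in H}.

HB.instance Definition _ := SubChoice.on subgroup.
HB.instance Definition _ := [SubChoice_isSubZmodule of subgroup by <:].
HB.instance Definition _ :=
  Topological.copy subgroup (initial_topology (val : subgroup -> G)).

Fact subgroup_val_continuous : continuous (val : subgroup -> G).
Proof. exact: initial_continuous. Qed.

Fact subgroup_sub_continuous :
  continuous (fun x : subgroup * subgroup => x.1 - x.2).
Proof.
apply: (@continuous_comp_initial _ _ _ (val : subgroup -> G)).
rewrite (_ : _ \o _ = (fun x : G * G => x.1 - x.2) \o
    (fun x : subgroup * subgroup => (val x.1, val x.2))); last first.
  by apply/funext => x; exact: (raddfB (val : subgroup -> G)).
move=> x; apply: continuous_comp; last exact: sub_continuous.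
apply: cvg_pair; apply: continuous_comp.
- exact: cvg_fst.
- exact: subgroup_val_continuous.
- exact: cvg_snd.
- exact: subgroup_val_continuous.
Qed.

HB.instance Definition _ :=
  PreTopologicalNmodule_isTopologicalZmodule.Build subgroup
    subgroup_sub_continuous.

End Subgroup.

Section QuotientGroup.
Local Open Scope quotient_scope.
Variables (G : topologicalZmodType) (H : zmodClosed G).

Definition quotient_group := quotient_topology (Quotient.quot H).

HB.instance Definition _ := Topological.on quotient_group.
HB.instance Definition _ := Quotient.on quotient_group.
HB.instance Definition _ := GRing.isZmodule.Build quotient_group
  (@Quotient.addqA G H) (@Quotient.addqC G H)
  (@Quotient.add0q G H) (@Quotient.addNq G H).

Local Notation pi := (\pi_quotient_group : G -> quotient_group).

Fact quotient_pi_zmod_morphism : zmod_morphism pi.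
Proof. exact: (raddfB (\pi_(Quotient.quot H))). Qed.

HB.instance Definition _ :=
  GRing.isZmodMorphism.Build G quotient_group \pi_quotient_group
    quotient_pi_zmod_morphism.

Fact quotient_piP (x y : G) : pi x = pi y <-> x - y \in H.
Proof.
by rewrite Quotient.idealrBE; split => [pxy|/eqP//]; exact/eqP.
Qed.

Fact quotient_pi_open (U : set G) : open U -> open (pi @` U).
Proof.
move=> oU; rewrite /open /= /quotient_open.
rewrite (_ : _ @^-1` _ =
    \bigcup_(h in [set` H]) ((fun x => x - h) @^-1` U)); last first.
  apply/seteqP; split => [x [u Uu /quotient_piP uxH]|x [h /= hH Uxh]].
    exists (x - u); first by rewrite /= -opprB rpredN.
    by rewrite /= subKr.
  by exists (x - h) => //; apply/quotient_piP; rewrite addrAC subrr add0r rpredN.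
apply: bigcup_open => h _; apply: open_comp oU => x _.
apply: (@continuous_comp _ _ _ (fun x => (x, h)) (fun x : G * G => x.1 - x.2)).
  by apply: cvg_pair; [exact: cvg_id|exact: cvg_cst].
exact: sub_continuous.
Qed.

Fact quotient_sub_continuous :
  continuous (fun x : quotient_group * quotient_group => x.1 - x.2).
Proof.
have piE (a : quotient_group) : exists x, a = pi x.
  by exists (repr a); rewrite reprK.
move=> [a b]; have [x ->] := piE a; have [y ->] := piE b => W /=.
rewrite -(raddfB pi) => nW.
have cB : {for (x, y), continuous (fun z : G * G => pi (z.1 - z.2))}.
  by apply: continuous_comp; [exact: sub_continuous|exact: pi_continuous].
have [[A B] [/= nA nB] ABW] := cB W nW.
exists (pi @` A^°, pi @` B^°) => /=.
  split; apply: open_nbhs_nbhs; split.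
  - exact/quotient_pi_open/open_interior.
  - by exists x.
  - exact/quotient_pi_open/open_interior.
  - by exists y.
move=> [_ _] [/= [u Au <-] [v Bv <-]]; rewrite /= -(raddfB pi).
by apply: (ABW (u, v)); split; exact: interior_subset.
Qed.

HB.instance Definition _ :=
  PreTopologicalNmodule_isTopologicalZmodule.Build quotient_group
    quotient_sub_continuous.

End QuotientGroup.


(* For [f] into a space [B], the open sets of [range f] are the traces
   [V `&` range f] of the open sets [V] of [B]. *)
Definition open_onto_image (A B : topologicalType) (f : A -> B) : Prop :=
  forall U : set A, open U ->
    exists2 V : set B, open V & f @` U = V `&` range f.

Definition is_character (R : realType) (G : topologicalZmodType)
    (chi : {additive G -> circle R}) : Prop :=
  continuous chi.

Definition dually_embedded (R : realType) (G : topologicalZmodType)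
    (H : zmodClosed G) : Prop :=
  forall chi : {additive subgroup H -> circle R}, is_character chi ->
    exists2 psi : {additive G -> circle R}, is_character psi &
      forall h : subgroup H, psi (val h) = chi h.

Record twisted_sum (Y X Z : topologicalZmodType)
    (i : {additive Y -> X}) (p : {additive X -> Z}) : Prop := TwistedSum {
  twisted_sum_continuous_inj : continuous i;
  twisted_sum_continuous_proj : continuous p;
  twisted_sum_injective : injective i;
  twisted_sum_exact : range i = p @^-1` [set 0];
  twisted_sum_surjective : range p = setT;
  twisted_sum_open_inj : open_onto_image i;
  twisted_sum_open_proj : open_onto_image p
}.

Definition twisted_sum_splits (Y X Z : topologicalZmodType)
    (i : {additive Y -> X}) (p : {additive X -> Z}) : Prop :=
  exists Phi : {additive X -> (Y * Z)%type},
    [/\ continuous Phi,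
        forall y : Y, Phi (i y) = (y, 0) &
        forall x : X, (Phi x).2 = p x].

Definition S_TG (R : realType) (G : topologicalZmodType) : Prop :=
  forall (X : topologicalZmodType)
    (i : {additive circle R -> X}) (p : {additive X -> G}),
    twisted_sum i p -> twisted_sum_splits i p.

(* Main.v *)
From HB Require Import structures.
Require Import Defs.
From mathcomp Require Import all_boot all_order all_algebra ring_quotient.
From mathcomp Require Import all_classical all_reals topology normedtype.

Set Implicit Arguments.
Unset Strict Implicit.
Unset Printing Implicit Defensive.

Import GRing.Theory.

Local Open Scope classical_set_scope.
Local Open Scope ring_scope.

(**
  Both parts rest on one reformulation: a twisted sum [i : Y -> X],
  [p : X -> Z] splits exactly when [i] has a continuous additive retraction
  [s : X -> Y], the splitting then being [x |-> (s x, p x)]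
  ([splits_retraction], [retraction_splits]).  Below, [T] is the circle group.

  Part (1).  Given a character [chi] of [H], the push-out of
  [H -> G -> G/H] along [chi] is the quotient of [T * G] by the subgroup of
  the pairs [(- chi h, h)].  It is a twisted sum of [T] and [G/H]
  ([pushout_twisted_sum]), so it retracts onto [T].  In the push-out the
  classes of [(0, h)] and [(chi h, 0)] agree, hence composing [G -> push-out]
  with the retraction gives a character of [G] that extends [chi].  The
  delicate point is that [T -> push-out] is open onto its image: that is where
  the continuity of [chi] enters ([pushout_open_inl]).

  Part (2).  Given a twisted sum of [T] and [G/H] with middle term [X], its
  pull-back along the projection [q : G -> G/H] is the group of the pairs
  [(x, g)] with [p x = q g].  It is a twisted sum of [T] and [G]
  ([pullback_twisted_sum]), so it has a retraction [s] onto [T].  The kernel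
  of the projection of the pull-back to [X] is a copy of [H]: it consists of
  the pairs [(0, h)].  On it [s] restricts to a character of [H], which
  extends to a character [psi] of [G].  Then [(x, g) |-> s (x, g) - psi g] is
  still a retraction and vanishes on that kernel.  Since [q] is an open
  surjection so is the projection of the pull-back to [X], and therefore this
  map descends to a continuous retraction of [X] onto [T]
  ([pullback_descent]).
*)

(** * Products of topological Abelian groups *)

Section Continuity.
Variables S A B : topologicalType.

Lemma continuous_compT (f : S -> A) (g : A -> B) :
  continuous f -> continuous g -> continuous (g \o f).
Proof. by move=> cf cg x; apply: continuous_comp; [exact: cf|exact: cg]. Qed.

Lemma continuous_pair (f : S -> A) (g : S -> B) :
  continuous f -> continuous g -> continuous (fun x => (f x, g x)).
Proof. by move=> cf cg x; apply: cvg_pair; [exact: cf|exact: cg]. Qed.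

Lemma continuous_fst : continuous (fst : A * B -> A).
Proof. by move=> x; exact: cvg_fst. Qed.

Lemma continuous_snd : continuous (snd : A * B -> B).
Proof. by move=> x; exact: cvg_snd. Qed.

End Continuity.

Lemma continuousB (S : topologicalType) (A : topologicalZmodType)
    (f g : S -> A) :
  continuous f -> continuous g -> continuous (fun x => f x - g x).
Proof.
move=> cf cg.
exact: (continuous_compT (continuous_pair cf cg) (@sub_continuous A)).
Qed.

Section ProductGroup.
Variables A B : topologicalZmodType.

(** A name of its own for the product keeps its group topology apart from the
    structures that [A * B] inherits when the factors are topological vector
    spaces. *)
Definition prod_group : Type := (A * B)%type.

HB.instance Definition _ := Topological.copy prod_group (A * B)%type.
HB.instance Definition _ := GRing.Zmodule.copy prod_group (A * B)%type.

Fact prod_sub_continuous :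
  continuous (fun z : prod_group * prod_group => z.1 - z.2).
Proof.
have c1 : continuous (fun z : (A * B) * (A * B) => z.1.1 - z.2.1).
  apply: continuousB => x.
  - by apply: continuous_comp; [exact: cvg_fst|exact: cvg_fst].
  - by apply: continuous_comp; [exact: cvg_snd|exact: cvg_fst].
have c2 : continuous (fun z : (A * B) * (A * B) => z.1.2 - z.2.2).
  apply: continuousB => x.
  - by apply: continuous_comp; [exact: cvg_fst|exact: cvg_snd].
  - by apply: continuous_comp; [exact: cvg_snd|exact: cvg_snd].
exact: (continuous_pair c1 c2).
Qed.

HB.instance Definition _ :=
  PreTopologicalNmodule_isTopologicalZmodule.Build prod_group
    prod_sub_continuous.

End ProductGroup.

(** * Twisted sums and retractions *)

Section TwistedSum.
Variables (Y X Z : topologicalZmodType).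
Variables (i : {additive Y -> X}) (p : {additive X -> Z}).

Lemma twisted_sum_projK (y : Y) : twisted_sum i p -> p (i y) = 0.
Proof.
move=> ts; have : range i (i y) by exists y.
by rewrite (twisted_sum_exact ts).
Qed.

Lemma twisted_sum_open_map (U : set X) :
  twisted_sum i p -> open U -> open (p @` U).
Proof.
move=> ts /(twisted_sum_open_proj ts)[V oV ->].
by rewrite (twisted_sum_surjective ts) setIT.
Qed.

Lemma splits_retraction : twisted_sum_splits i p ->
  exists2 s : {additive X -> Y}, continuous s & forall y, s (i y) = y.
Proof.
move=> [Phi [cPhi Phii _]]; exists (fst \o Phi) => [|y] /=.
  exact: (continuous_compT cPhi (@continuous_fst Y Z)).
by rewrite Phii.
Qed.

Lemma retraction_splits (s : {additive X -> Y}) : twisted_sum i p ->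
  continuous s -> (forall y, s (i y) = y) -> twisted_sum_splits i p.
Proof.
move=> ts cs si.
have Phi_additive : zmod_morphism (fun x => (s x, p x)).
  by move=> x y; rewrite !raddfB.
pose PhiM := GRing.isZmodMorphism.Build _ _ _ Phi_additive.
pose Phi : {additive X -> (Y * Z)%type} :=
  HB.pack (fun x => (s x, p x)) PhiM.
exists Phi; split => // [|y].
  exact: (continuous_pair cs (twisted_sum_continuous_proj ts)).
by rewrite /= si (twisted_sum_projK y ts).
Qed.

End TwistedSum.

(** * The push-out along a homomorphism defined on a subgroup *)

Section Pushout.
Variables (G Y : topologicalZmodType) (H : zmodClosed G).
Variable chi : {additive subgroup H -> Y}.
Hypothesis chi_continuous : continuous chi.

(** The graph of [- chi], seen in [Y * G]: dividing by it identifies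
    [(chi h, 0)] with [(0, h)]. *)
Definition antidiagonal_pred : pred (prod_group Y G) :=
  fun z => `[< exists2 h : subgroup H, z.1 = - chi h & z.2 = val h >].

Fact antidiagonal_zmod_closed : zmod_closed antidiagonal_pred.
Proof.
split.
  by rewrite unfold_in; apply/asboolP; exists 0; rewrite ?raddf0 ?oppr0.
move=> x y; rewrite !unfold_in => /asboolP[h x1 x2] /asboolP[k y1 y2].
apply/asboolP.
exists (h - k) => /=; last by rewrite x2 y2.
by rewrite x1 y1 (raddfB chi) opprB opprK addrC.
Qed.

HB.instance Definition _ :=
  GRing.isZmodClosed.Build _ antidiagonal_pred antidiagonal_zmod_closed.

Definition antidiagonal : zmodClosed (prod_group Y G) :=
  GRing.ZmodClosed.clone _ antidiagonal_pred _.

Definition pushout := @quotient_group (prod_group Y G) antidiagonal.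

HB.instance Definition _ := TopologicalZmodule.on pushout.

Local Notation pi := (\pi_pushout%qT : prod_group Y G -> pushout).
Local Notation piG := (\pi_(quotient_group H)%qT : G -> quotient_group H).

Lemma pushout_piP (y z : Y) (g k : G) : pi (y, g) = pi (z, k) <->
  exists2 h : subgroup H, y = z - chi h & g = k + val h.
Proof.
rewrite quotient_piP; split=> [/asboolP[h /= yz gk]|[h -> ->]].
  by exists h; [rewrite -yz|rewrite -gk]; rewrite addrC subrK.
apply/asboolP; exists h => /=; first by rewrite addrAC subrr add0r.
by rewrite addrAC subrr add0r.
Qed.

Definition pushout_inl (y : Y) : pushout := pi (y, 0).
Definition pushout_inr (g : G) : pushout := pi (0, g).
Definition pushout_proj (x : pushout) : quotient_group H := piG (repr x).2.

Lemma pushout_inl_zmod_morphism : zmod_morphism pushout_inl.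
Proof.
by move=> y z; rewrite /pushout_inl -raddfB; congr (pi (_, _)); rewrite subr0.
Qed.
HB.instance Definition _ :=
  GRing.isZmodMorphism.Build _ _ pushout_inl pushout_inl_zmod_morphism.

Lemma pushout_inr_zmod_morphism : zmod_morphism pushout_inr.
Proof.
by move=> y z; rewrite /pushout_inr -raddfB; congr (pi (_, _)); rewrite subr0.
Qed.
HB.instance Definition _ :=
  GRing.isZmodMorphism.Build _ _ pushout_inr pushout_inr_zmod_morphism.

Lemma pushout_piE (x : pushout) : exists z : prod_group Y G, x = pi z.
Proof. by exists (repr x); rewrite reprK. Qed.

Lemma pushout_proj_pi (z : prod_group Y G) : pushout_proj (pi z) = piG z.2.
Proof.
case: z => y g; apply/quotient_piP.
case E : (repr (pi (y, g))) => [y' g'] /=.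
have : pi (y', g') = pi (y, g) by rewrite -E reprK.
by move=> /pushout_piP[h _ ->]; rewrite addrAC subrr add0r; exact: valP.
Qed.

Lemma pushout_proj_zmod_morphism : zmod_morphism pushout_proj.
Proof.
move=> x y; have [a ->] := pushout_piE x; have [b ->] := pushout_piE y.
by rewrite -raddfB !pushout_proj_pi /= raddfB.
Qed.
HB.instance Definition _ :=
  GRing.isZmodMorphism.Build _ _ pushout_proj pushout_proj_zmod_morphism.

Lemma pushout_pi_continuous : continuous pi.
Proof. exact: pi_continuous. Qed.

Lemma pushout_inl_continuous : continuous pushout_inl.
Proof.
apply: (@continuous_compT _ _ _ (fun y => (y, 0)) pi); last first.
  exact: pushout_pi_continuous.
by apply: continuous_pair => y; [exact: cvg_id|exact: cvg_cst].
Qed.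

Lemma pushout_inr_continuous : continuous pushout_inr.
Proof.
apply: (@continuous_compT _ _ _ (fun g => (0, g)) pi); last first.
  exact: pushout_pi_continuous.
by apply: continuous_pair => y; [exact: cvg_cst|exact: cvg_id].
Qed.

Lemma pushout_proj_continuous : continuous pushout_proj.
Proof.
apply/quotient_continuous.
rewrite (_ : _ \o _ = piG \o snd); last first.
  by apply/funext => z; exact: pushout_proj_pi.
by apply: continuous_compT; [exact: continuous_snd|exact: pi_continuous].
Qed.

Lemma pushout_inl_inj : injective pushout_inl.
Proof.
move=> y z /pushout_piP[h -> /esym]; rewrite add0r => h0.
have -> : h = 0 by apply: val_inj.
by rewrite raddf0 subr0.
Qed.

Lemma pushout_inr_subgroup (h : subgroup H) :
  pushout_inr (val h) = pushout_inl (chi h).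
Proof. by apply/pushout_piP; exists h; rewrite ?subrr ?add0r. Qed.

Lemma pushout_exact : range pushout_inl = pushout_proj @^-1` [set 0].
Proof.
apply/seteqP; split => [_ [y _ <-]|x] /=.
  by rewrite pushout_proj_pi raddf0.
have [[y g] ->] := pushout_piE x; rewrite pushout_proj_pi -(raddf0 piG).
move=> /quotient_piP; rewrite /= subr0 => gH.
exists (y + chi (Sub g gH)) => //; apply/esym/pushout_piP.
by exists (Sub g gH); rewrite ?addrK ?add0r ?SubK.
Qed.

Lemma pushout_proj_surjective : range pushout_proj = setT.
Proof.
apply/seteqP; split => // x _; exists (pushout_inr (repr x)) => //.
by rewrite pushout_proj_pi reprK.
Qed.

(** For [U] open, the pairs [(z, g)] such that [z + chi h] is in [U] as soon as
    [g] is some [h] in [H] form a set [M] whose image meets [Y] in [U].  At the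
    points [(u, 0)] with [u] in [U] it is a neighbourhood, because
    [(y, h) |-> y + chi h] is continuous and [H] carries the induced topology;
    so the interior of [M] is large enough. *)
Lemma pushout_open_inl : open_onto_image pushout_inl.
Proof.
move=> U oU.
pose M := [set z : prod_group Y G |
  forall h : subgroup H, z.2 = val h -> U (z.1 + chi h)].
have oM : open (M°) by exact: open_interior.
exists (pi @` M°); first exact: quotient_pi_open.
apply/seteqP; split => [_ [u Uu <-]|_ [[[s g] Msg <-] [t _]]].
  split; last by exists u.
  exists (u, 0) => //.
  have cD : continuous (fun z : Y * subgroup H => z.1 + chi z.2).
    apply: (@continuous_compT _ (Y * Y)%type _ (fun z => (z.1, chi z.2))
      (fun z => z.1 + z.2)); last exact: add_continuous.
    apply: continuous_pair; first exact: continuous_fst.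
    exact: (continuous_compT (@continuous_snd _ _) chi_continuous).
  have : nbhs (u + chi 0) U by rewrite raddf0 addr0; exact: open_nbhs_nbhs.
  move=> /(cD (u, 0)) [[A B] [/= nA nB] ABU].
  (* [B] contains the trace on [H] of an open set [O] of [G]. *)
  move: nB; rewrite nbhsE => -[_ [[O oO <-] O0] OB].
  exists (A, O) => /=.
    by split=> //; apply: open_nbhs_nbhs; split.
  move=> [a g] [/= Aa Og] h /= gh; apply: (ABU (a, h)); split => //.
  by apply: OB; rewrite /= -gh.
move=> tE; exists t => //; move/esym/pushout_piP: (tE) => [h sE gE].
move: (interior_subset Msg h); rewrite /= sE gE add0r subrK; exact.
Qed.

Lemma pushout_open_proj : open_onto_image pushout_proj.
Proof.
move=> U oU; exists (pushout_proj @` U); last first.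
  by rewrite pushout_proj_surjective setIT.
rewrite (_ : _ @` _ = piG @` (snd @` (pi @^-1` U))).
  apply/quotient_pi_open/snd_open.
  by move/continuousP: pushout_pi_continuous; exact.
apply/seteqP; split => [_ [x Ux <-]|_ [_ [z Uz <-] <-]].
  exists (repr x).2 => //; exists (repr x) => //.
  by rewrite /= reprK.
by exists (pi z) => //; exact: pushout_proj_pi.
Qed.

Lemma pushout_twisted_sum : twisted_sum pushout_inl pushout_proj.
Proof.
split; [exact: pushout_inl_continuous|exact: pushout_proj_continuous|
  exact: pushout_inl_inj|exact: pushout_exact|exact: pushout_proj_surjective|
  exact: pushout_open_inl|exact: pushout_open_proj].
Qed.

End Pushout.

(** * The pull-back along a homomorphism into the quotient *)

(** Stated with [A] open in the whole product, so that by symmetry it serves for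
    both projections of a pull-back. *)
Lemma fiber_product_open (X W Z : topologicalType) (p : X -> Z) (f : W -> Z)
    (A : set (X * W)) :
  (forall U, open U -> open (p @` U)) -> continuous f -> open A ->
  open [set w | exists2 x, p x = f w & A (x, w)].
Proof.
move=> op cf oA; rewrite openE => w [x xw Axw].
have [[B C] [/= nB nC] BCA] : nbhs (x, w) A by exact: open_nbhs_nbhs.
have nD : nbhs w (f @^-1` (p @` B°)).
  apply: cf; apply: open_nbhs_nbhs; split; first exact/op/open_interior.
  by exists x.
apply: filterS (filterI nD nC) => v [[y By yv] Cv].
by exists y => //; apply: BCA; split => //; exact: interior_subset.
Qed.

Section Pullback.
Variables (Y X Z W : topologicalZmodType).
Variables (i : {additive Y -> X}) (p : {additive X -> Z}).
Variable f : {additive W -> Z}.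

Definition fiber_product_pred : pred (prod_group X W) :=
  fun z => p z.1 == f z.2.

Fact fiber_product_zmod_closed : zmod_closed fiber_product_pred.
Proof.
split; first by rewrite unfold_in /= !raddf0.
by move=> x y; rewrite !unfold_in => /eqP xE /eqP yE; rewrite !raddfB xE yE.
Qed.

HB.instance Definition _ :=
  GRing.isZmodClosed.Build _ fiber_product_pred fiber_product_zmod_closed.

Definition fiber_product : zmodClosed (prod_group X W) :=
  GRing.ZmodClosed.clone _ fiber_product_pred _.

Definition pullback := @subgroup (prod_group X W) fiber_product.

HB.instance Definition _ := TopologicalZmodule.on pullback.

Definition pullback_fst (z : pullback) : X := (val z).1.
Definition pullback_snd (z : pullback) : W := (val z).2.

Lemma pullbackP (z : pullback) : p (pullback_fst z) = f (pullback_snd z).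
Proof. exact/eqP/(valP z). Qed.

Definition pullback_pair (x : X) (w : W) (e : p x = f w) : pullback :=
  @exist _ (fun z => z \in fiber_product) (x, w) (introT eqP e).

Lemma pullback_fst_zmod_morphism : zmod_morphism pullback_fst.
Proof. by []. Qed.
HB.instance Definition _ :=
  GRing.isZmodMorphism.Build _ _ pullback_fst pullback_fst_zmod_morphism.

Lemma pullback_snd_zmod_morphism : zmod_morphism pullback_snd.
Proof. by []. Qed.
HB.instance Definition _ :=
  GRing.isZmodMorphism.Build _ _ pullback_snd pullback_snd_zmod_morphism.

Lemma pullback_fst_continuous : continuous pullback_fst.
Proof.
exact: (@continuous_compT pullback (prod_group X W) X val fst
  (@subgroup_val_continuous _ _) (@continuous_fst X W)).
Qed.

Lemma pullback_snd_continuous : continuous pullback_snd.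
Proof.
exact: (@continuous_compT pullback (prod_group X W) W val snd
  (@subgroup_val_continuous _ _) (@continuous_snd X W)).
Qed.

Lemma pullback_continuous (S : topologicalType) (g : S -> pullback) :
  continuous (pullback_fst \o g) -> continuous (pullback_snd \o g) ->
  continuous g.
Proof.
move=> c1 c2.
apply: (@continuous_comp_initial _ _ _ (val : pullback -> prod_group X W)).
rewrite (_ : _ \o g =
  fun x => ((pullback_fst \o g) x, (pullback_snd \o g) x)).
  exact: (continuous_pair c1 c2).
by apply/funext => x; exact: surjective_pairing.
Qed.

Lemma pullback_inj (z t : pullback) : pullback_fst z = pullback_fst t ->
  pullback_snd z = pullback_snd t -> z = t.
Proof.
move=> e1 e2; apply: val_inj; move: e1 e2; rewrite /pullback_fst /pullback_snd.
by case: (val z) => ? ?; case: (val t) => ? ? /= -> ->.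
Qed.

Hypothesis ts : twisted_sum i p.

Fact pullback_inl_subproof (y : Y) : p (i y) = f 0.
Proof. by rewrite (twisted_sum_projK _ ts) raddf0. Qed.

Definition pullback_inl (y : Y) : pullback :=
  pullback_pair (pullback_inl_subproof y).

Lemma pullback_inl_zmod_morphism : zmod_morphism pullback_inl.
Proof.
by move=> x y; apply: pullback_inj; rewrite raddfB /= /pullback_fst /=
  /pullback_snd /= ?raddfB ?subr0.
Qed.
HB.instance Definition _ :=
  GRing.isZmodMorphism.Build _ _ pullback_inl pullback_inl_zmod_morphism.

Lemma pullback_inl_continuous : continuous pullback_inl.
Proof.
apply: pullback_continuous; first exact: twisted_sum_continuous_inj ts.
by move=> y; exact: cvg_cst.
Qed.

Lemma pullback_twisted_sum : continuous f ->
  twisted_sum pullback_inl pullback_snd.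
Proof.
move=> cf; split.
- exact: pullback_inl_continuous.
- exact: pullback_snd_continuous.
- move=> y z /(congr1 pullback_fst).
  exact: (twisted_sum_injective ts).
- apply/seteqP; split => [_ [y _ <-]//|z /= z0].
  have : range i (pullback_fst z).
    by rewrite (twisted_sum_exact ts) /= pullbackP z0 raddf0.
  by move=> [y _ yz]; exists y => //; exact: pullback_inj.
- apply/seteqP; split => // w _.
  have : range p (f w) by rewrite (twisted_sum_surjective ts).
  by move=> [x _ xw]; exists (pullback_pair xw).
- move=> U /(twisted_sum_open_inj ts)[V oV UV].
  exists (pullback_fst @^-1` V).
    by move/continuousP: pullback_fst_continuous; exact.
  apply/seteqP; split => [_ [y Uy <-]|z [Vy [y _ yE]]].
    have : (i @` U) (i y) by exists y.
    by rewrite UV => -[Vy _]; split => //; exists y.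
  have : (i @` U) (i y).
    by rewrite UV; split; [move: Vy; rewrite -yE|exists y].
  by move=> [u Uu /(twisted_sum_injective ts) uy]; exists u; rewrite // -yE uy.
- move=> _ [A oA <-]; exists (pullback_snd @` (val @^-1` A)); last first.
    by apply/seteqP; split => [_ [z Az <-]|w []//]; split; exists z.
  rewrite (_ : _ @` _ = [set w | exists2 x, p x = f w & A (x, w)]).
    exact: fiber_product_open (fun U => twisted_sum_open_map ts) cf oA.
  apply/seteqP; split => [_ [z Az <-]|w [x xw Axw]].
    exists (pullback_fst z); first exact: pullbackP.
    by move: Az; rewrite /pullback_fst /pullback_snd /=; case: (val z).
  by exists (pullback_pair xw).
Qed.

Lemma pullback_fst_open (A : set pullback) :
  (forall U, open U -> open (f @` U)) ->
  open A -> open (pullback_fst @` A).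
Proof.
move=> of_ [B oB <-].
pose swap (z : W * X) := (z.2, z.1).
have cswap : continuous swap.
  by apply: continuous_pair; [exact: continuous_snd|exact: continuous_fst].
rewrite (_ : _ @` _ = [set x | exists2 w, f w = p x & (swap @^-1` B) (w, x)]).
  apply: fiber_product_open of_ (twisted_sum_continuous_proj ts) _.
  by move/continuousP: cswap; exact.
apply/seteqP; split => [_ [z Bz <-]|x [w xw Bxw]].
  exists (pullback_snd z); first exact/esym/pullbackP.
  by move: Bz; rewrite /pullback_fst /pullback_snd /=; case: (val z).
by exists (pullback_pair (esym xw)).
Qed.

(** The projection to [X] is an open surjection, as [f] is one, so [X] carries
    the quotient topology and homomorphisms out of the pull-back that kill the
    kernel factor through it. *)
Lemma pullback_descent (A : topologicalZmodType)
    (r : {additive pullback -> A}) :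
  (forall U, open U -> open (f @` U)) -> range f = setT ->
  continuous r -> (forall z, pullback_fst z = 0 -> r z = 0) ->
  exists2 rho : {additive X -> A}, continuous rho &
    forall z, rho (pullback_fst z) = r z.
Proof.
move=> of_ sf cr r0.
have r_fst (z t : pullback) : pullback_fst z = pullback_fst t -> r z = r t.
  move=> zt; apply/eqP; rewrite -subr_eq0 -(raddfB r) r0//.
  by rewrite pullback_fst_zmod_morphism zt subrr.
have lift (x : X) : exists w, p x = f w.
  have : range f (p x) by rewrite sf.
  by move=> [w _ fw]; exists w.
have [g gE] := choice lift.
pose rho x := r (pullback_pair (gE x)).
have rhoE (z : pullback) : rho (pullback_fst z) = r z by exact: r_fst.
have rhoB : zmod_morphism rho.
  by move=> x y; rewrite /rho -(raddfB r); exact: r_fst.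
pose rhoM := GRing.isZmodMorphism.Build _ _ _ rhoB.
exists (HB.pack rho rhoM : {additive X -> A}) => //=.
apply/continuousP => V oV.
rewrite (_ : _ @^-1` _ = pullback_fst @` (r @^-1` V)).
  by apply: pullback_fst_open => //; move/continuousP: cr; exact.
apply/seteqP; split => [x Vx|_ [z Vz <-]]; last by rewrite /= rhoE.
by exists (pullback_pair (gE x)).
Qed.

End Pullback.

(** * The two inheritance statements *)

Lemma S_TG_quotient_dually_embedded (R : realType) (G : topologicalZmodType)
    (H : zmodClosed G) : S_TG R (quotient_group H) -> dually_embedded R H.
Proof.
move=> STG chi cchi.
have /splits_retraction[s cs si] := STG _ _ _ (pushout_twisted_sum cchi).
exists (s \o pushout_inr chi) => [|h].
  exact: (continuous_compT (@pushout_inr_continuous _ _ _ chi) cs).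
by rewrite /= pushout_inr_subgroup si.
Qed.

(** A splitting of the pull-back need not vanish on the copy [(0, h)] of [H];
    the extension [psi] to [G] of its restriction to [H] is subtracted to
    correct that. *)
Lemma S_TG_quotient (R : realType) (G : topologicalZmodType)
    (H : zmodClosed G) :
  S_TG R G -> dually_embedded R H -> S_TG R (quotient_group H).
Proof.
move=> STG dual X i p ts.
pose q : {additive G -> quotient_group H} := \pi_(quotient_group H)%qT.
have cq : continuous q by exact: pi_continuous.
have /splits_retraction[s cs si] := STG _ _ _ (pullback_twisted_sum ts cq).
have qH (h : subgroup H) : p 0 = q (val h).
  rewrite raddf0 -(raddf0 q); apply/esym/quotient_piP.
  by rewrite subr0; exact: valP.
have chi_additive :
    zmod_morphism (fun h : subgroup H => s (pullback_pair (qH h))).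
  move=> h k; rewrite -raddfB; congr (s _); apply: pullback_inj => //.
  by rewrite /pullback_fst /= subr0.
pose chiM := GRing.isZmodMorphism.Build _ _ _ chi_additive.
pose chi : {additive subgroup H -> circle R} :=
  HB.pack (fun h : subgroup H => s (pullback_pair (qH h))) chiM.
have [|psi cpsi psichi] := dual chi.
  apply: continuous_compT cs.
  apply: pullback_continuous; last exact: subgroup_val_continuous.
  exact: (@cst_continuous (subgroup H) X 0).
pose r (z : pullback p q) := s z - psi (pullback_snd z).
have rB : zmod_morphism r.
  by move=> z t; rewrite /r !raddfB /= !opprK addrACA.
pose rM := GRing.isZmodMorphism.Build _ _ _ rB.
pose rA : {additive pullback p q -> circle R} := HB.pack r rM.
have cr : continuous rA.
  apply: continuousB => //.
  exact: (continuous_compT (@pullback_snd_continuous _ _ _ p q) cpsi).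
have r0 (z : pullback p q) : pullback_fst z = 0 -> rA z = 0.
  move=> z0; have zH : pullback_snd z \in H.
    rewrite -[pullback_snd z]subr0; apply/quotient_piP.
    by rewrite -[LHS]/(q _) -pullbackP z0 !raddf0.
  pose h : subgroup H := exist (fun g => g \in H) _ zH.
  have -> : z = pullback_pair (qH h) by exact: pullback_inj.
  by apply/eqP; rewrite subr_eq0; apply/eqP; exact/esym/(psichi h).
have q_surjective : range q = setT.
  by apply/seteqP; split => // a _; exists (repr a) => //; apply: reprK.
have [rho crho rhoE] :=
  pullback_descent ts (@quotient_pi_open _ H) q_surjective cr r0.
apply: (retraction_splits ts crho) => y.
rewrite -[RHS]si -[i y]/(pullback_fst (pullback_inl q ts y)) rhoE /= /r.
by rewrite /pullback_snd /= raddf0 subr0.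
Qed.

Theorem theorem2p17 (R : realType) (G : topologicalZmodType) :
  (forall H : zmodClosed G, closed [set` H] ->
     S_TG R (quotient_group H) -> dually_embedded R H) /\
  (S_TG R G ->
   forall H : zmodClosed G, closed [set` H] -> dually_embedded R H ->
     S_TG R (quotient_group H)).
Proof.
split=> [H _|STG H _]; first exact: S_TG_quotient_dually_embedded.
exact: S_TG_quotient.
Qed.
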